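(* Let $R$ be a ring which is semiprime, and let $(P,Q,\psi)$ be an $R$-system which satisfies condition (FS). Then $(\ker\Delta)^\perp\cap\ker\Delta=\{0\}$.
   Context: Rings are associative, not necessarily unital. A ring $R$ is semiprime if whenever $I$ is a two-sided ideal of $R$ with $I^2=\{0\}$, then $I=\{0\}$. For $R$-bimodules $P,Q$, $P\otimes Q$ is the $R$-balanced tensor product. An $R$-system is a triple $(P,Q,\psi)$ where $P,Q$ are $R$-bimodules and $\psi:P\otimes Q\to R$ is an $R$-bimodule homomorphism. For $p\in P,q\in Q$: $\theta_{q,p}:Q\to Q$, $x\mapsto q\psi(p\otimes x)$, and $\theta_{p,q}:P\to P$, $y\mapsto\psi(y\otimes q)p$. $\mathcal{F}_P(Q)$ is the additive span of all $\theta_{q,p}$, $\mathcal{F}_Q(P)$ the additive span of all $\theta_{p,q}$. Condition (FS): for all finite sets $\{q_1,\dots,q_n\}\subseteq Q$, $\{p_1,\dots,p_m\}\subseteq P$ there exist $\Theta\in\mathcal{F}_P(Q)$ and $\Omega\in\mathcal{F}_Q(P)$ with $\Theta(q_i)=q_i$ and $\Omega(p_j)=p_j$ for all $i,j$. $\Delta:R\to\operatorname{End}(Q_R)$ is the ring homomorphism $\Delta(r)(q)=rq$. For a two-sided ideal $J$ of $R$, $J^\perp:=\{x\in R:\ xy=yx=0\text{ for all }y\in J\}$. *)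

(* Defs.v *)
From HB Require Import structures.
From mathcomp Require Export all_boot all_algebra.
From mathcomp Require Import generic_quotient ring_quotient freeg.
From mathcomp Require Export boolp classical_sets functions cardinality.

Set Implicit Arguments.
Unset Strict Implicit.
Unset Printing Implicit Defensive.

Import GRing.Theory.

Local Open Scope classical_set_scope.
Local Open Scope quotient_scope.
Local Open Scope ring_scope.

Reserved Notation "x ** y" (at level 40, left associativity).
Reserved Notation "r *>> x" (at level 40, left associativity).
Reserved Notation "x <<* r" (at level 40, left associativity).
Reserved Notation "P ⊗ Q" (at level 40, left associativity).
Reserved Notation "p ⊗t q" (at level 40, left associativity).
Reserved Notation "{ 'bimod' M -> N }"
  (at level 0, M at level 98, N at level 99, format "{ 'bimod'  M  ->  N }").

(* Associative rings, not necessarily unital. MathComp's own ring structures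
   all require a unit. *)

HB.mixin Record Zmodule_isRng R of GRing.Zmodule R := {
  rng_mul : R -> R -> R;
  rng_mulA : associative rng_mul;
  rng_mulDl : left_distributive rng_mul +%R;
  rng_mulDr : right_distributive rng_mul +%R
}.

#[short(type="rngType")]
HB.structure Definition Rng := {R of Zmodule_isRng R & GRing.Zmodule R}.

Notation "x ** y" := (rng_mul x y) : ring_scope.

(* No unitality of the actions is assumed. *)
HB.mixin Record Zmodule_isBimodule (R : rngType) M of GRing.Zmodule M := {
  lact : R -> M -> M;
  ract : M -> R -> M;
  lactDl : forall r s x, lact (r + s) x = lact r x + lact s x;
  lactDr : forall r x y, lact r (x + y) = lact r x + lact r y;
  lactA : forall r s x, lact (r ** s) x = lact r (lact s x);
  ractDl : forall x y r, ract (x + y) r = ract x r + ract y r;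
  ractDr : forall x r s, ract x (r + s) = ract x r + ract x s;
  ractA : forall x r s, ract x (r ** s) = ract (ract x r) s;
  lractA : forall r x s, ract (lact r x) s = lact r (ract x s)
}.

#[short(type="bimodType")]
HB.structure Definition Bimodule (R : rngType) :=
  {M of Zmodule_isBimodule R M & GRing.Zmodule M}.

Notation "r *>> x" := (lact r x) : ring_scope.
Notation "x <<* r" := (ract x r) : ring_scope.

(* R as a bimodule over itself; the alias carries the bimodule structure, in
   the way R^o does for MathComp's unital rings. *)
Definition regular_bimod (R : rngType) : Type := R.

Section Regular.
Variable R : rngType.

HB.instance Definition _ := GRing.Zmodule.on (regular_bimod R).

HB.instance Definition _ :=
  @Zmodule_isBimodule.Build R (regular_bimod R) (@rng_mul R) (@rng_mul R)
    (@rng_mulDl R) (@rng_mulDr R) (fun r s x => esym (@rng_mulA R r s x))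
    (@rng_mulDl R) (@rng_mulDr R) (@rng_mulA R)
    (fun r x s => esym (@rng_mulA R r x s)).

End Regular.

HB.mixin Record isBimodLinear (R : rngType) (M N : bimodType R) (f : M -> N) := {
  bimod_lact : forall r x, f (r *>> x) = r *>> f x;
  bimod_ract : forall x r, f (x <<* r) = f x <<* r
}.

#[short(type="bimodHomType")]
HB.structure Definition BimodHom (R : rngType) (M N : bimodType R) :=
  {f of isBimodLinear R M N f & @GRing.isNmodMorphism M N f}.

Notation "{ 'bimod' M -> N }" := (BimodHom.type M N) : type_scope.

Section AdditiveSpan.
Variable V : zmodType.

Definition is_subgroup (S : set V) : Prop :=
  S 0 /\ forall x y, S x -> S y -> S (x - y).

Definition addspan (A : set V) : set V := smallest is_subgroup A.

Lemma addspan_subgroup A : is_subgroup (addspan A).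
Proof.
split=> [S [[S0 _] _]|x y Ax Ay S SA] //.
by case: (SA) => [[_ SB] _]; apply: SB; [apply: Ax|apply: Ay].
Qed.

Lemma sub_addspan A : A `<=` addspan A.
Proof. exact: sub_gen_smallest. Qed.

Lemma addspan_sub A S : is_subgroup S -> A `<=` S -> addspan A `<=` S.
Proof. exact: smallest_sub. Qed.

End AdditiveSpan.

(* P ⊗ Q is the free abelian group on P * Q modulo the subgroup spanned by the
   biadditivity and R-balancedness relations; the outer actions are
   r (p ⊗ q) = (r p) ⊗ q and (p ⊗ q) r = p ⊗ (q r). *)

Section Tensor.
Variables (R : rngType) (P Q : bimodType R).

Local Notation F := {freeg (P * Q)%type / int}.
Local Notation gen p q := (<< (p, q) >> : F).

Definition tensor_rels : set F := [set x |
  [\/ exists p p' q, x = gen (p + p') q - gen p q - gen p' q,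
      exists p q q', x = gen p (q + q') - gen p q - gen p q' |
      exists p r q, x = gen (p <<* r) q - gen p (r *>> q)]].

Definition tensor_ker : {pred F} := fun x => x \in addspan tensor_rels.

Lemma tensor_ker_closed : zmod_closed tensor_ker.
Proof.
have [S0 SB] := addspan_subgroup tensor_rels.
split; rewrite /tensor_ker; first by rewrite unfold_in inE.
move=> x y; rewrite !unfold_in !inE; exact: SB.
Qed.

HB.instance Definition _ := GRing.isZmodClosed.Build F tensor_ker tensor_ker_closed.

Definition tensor : Type := Quotient.quot tensor_ker.

HB.instance Definition _ := GRing.Zmodule.on tensor.
HB.instance Definition _ := EqQuotient.on tensor.

Definition tmul (p : P) (q : Q) : tensor := \pi_tensor (gen p q).

Local Infix "⊗t" := tmul.

Lemma pi_tensorB (x y : F) : \pi_tensor (x - y) = \pi_tensor x - \pi_tensor y.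
Proof. exact: (@pi_is_zmod_morphism _ _ _ (Quotient.quot tensor_ker)). Qed.

Lemma pi_tensor0 : \pi_tensor 0 = 0.
Proof. by rewrite -[0 in LHS](subrr 0) pi_tensorB subrr. Qed.

Lemma pi_tensorD (x y : F) : \pi_tensor (x + y) = \pi_tensor x + \pi_tensor y.
Proof. by rewrite -[y in LHS]opprK -[- y]sub0r !pi_tensorB pi_tensor0 sub0r opprK. Qed.

Lemma pi_tensorP (x y : F) :
  \pi_tensor x = \pi_tensor y <-> addspan tensor_rels (x - y).
Proof.
have -> : addspan tensor_rels (x - y) = (x - y \in tensor_ker) :> Prop.
  by rewrite unfold_in inE.
by rewrite (Quotient.idealrBE tensor_ker); split=> /eqP.
Qed.

Lemma pi_tensor_rel (x y z : F) : tensor_rels (x - y - z) ->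
  \pi_tensor x = \pi_tensor y + \pi_tensor z.
Proof.
move=> h; rewrite -pi_tensorD; apply/pi_tensorP.
by rewrite opprD addrA; apply: sub_addspan.
Qed.

Lemma tmulDl p p' q : (p + p') ⊗t q = p ⊗t q + p' ⊗t q.
Proof. by apply: pi_tensor_rel; apply: Or31; exists p, p', q. Qed.

Lemma tmulDr p q q' : p ⊗t (q + q') = p ⊗t q + p ⊗t q'.
Proof. by apply: pi_tensor_rel; apply: Or32; exists p, q, q'. Qed.

Lemma tmul_balanced p r q : (p <<* r) ⊗t q = p ⊗t (r *>> q).
Proof. by apply/pi_tensorP; apply: sub_addspan; apply: Or33; exists p, r, q. Qed.

Lemma freeg_gen_ind (S : set F) : is_subgroup S ->
  (forall p q, S (gen p q)) -> forall x, S x.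
Proof.
move=> [S0 SB] Sg.
have SN x : S x -> S (- x) by rewrite -sub0r; apply: SB.
have SD x y : S x -> S y -> S (x + y) by move=> Sx /SN; rewrite -{2}[y]opprK; apply: SB.
have Sn (n : nat) a : S (<< n%:Z *g a >>).
  elim: n => [|n IH]; first by rewrite freegU0.
  by rewrite intS -freegUD; apply: SD => //; case: a {IH}.
elim/freeg_ind_dom0 => // k a D _ _ SDD; apply: SD => //.
by case: (intP k) => [|n|n]; rewrite -?freegUN; [exact: Sn|exact: Sn|apply/SN/Sn].
Qed.

Lemma tensor_ind (S : set tensor) : is_subgroup S ->
  (forall p q, S (p ⊗t q)) -> forall t, S t.
Proof.
move=> [S0 SB] Sg t; rewrite -[t]reprK.
apply: (@freeg_gen_ind [set x | S (\pi_tensor x)]) => //.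
by split=> [|x y Sx Sy] /=; rewrite ?pi_tensor0 // pi_tensorB; apply: SB.
Qed.

(* The endomorphism p ⊗ q |-> f p ⊗ g q; it is only used for pairs (f, g) that
   respect the tensor relations. *)
Definition tensor_map (f : P -> P) (g : Q -> Q) (t : tensor) : tensor :=
  \pi_tensor (fglift (fun x => gen (f x.1) (g x.2)) (repr t)).

Section TensorMap.
Variables (f : P -> P) (g : Q -> Q).
Hypothesis fD : {morph f : x y / x + y}.
Hypothesis gD : {morph g : x y / x + y}.
Hypothesis f_ract : forall p r, f (p <<* r) = f p <<* r.
Hypothesis g_lact : forall r q, g (r *>> q) = r *>> g q.

Local Notation h := (fglift (fun x : (P * Q)%type => gen (f x.1) (g x.2))).

Let hB : {morph h : x y / x - y}.
Proof. exact: lift_is_additive. Qed.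

Let hgen p q : h (gen p q) = gen (f p) (g q).
Proof. by rewrite liftU scale1r. Qed.

Let h0 : h 0 = 0.
Proof. by rewrite -[0 in LHS](subrr 0) hB subrr. Qed.

Let h_ker : addspan tensor_rels `<=` h @^-1` addspan tensor_rels.
Proof.
have [S0 SB] := addspan_subgroup tensor_rels.
apply: addspan_sub => [|x].
  by split=> [|x y Sx Sy]; rewrite /preimage /= ?h0 // hB; apply: SB.
rewrite /preimage /= => xR; apply: sub_addspan.
case: xR => -[a [b [c ->]]]; rewrite !hB !hgen.
- by rewrite fD; apply: Or31; exists (f a), (f b), (g c).
- by rewrite gD; apply: Or32; exists (f a), (g b), (g c).
- by rewrite f_ract g_lact; apply: Or33; exists (f a), b, (g c).
Qed.

Lemma tensor_map_pi x : tensor_map f g (\pi_tensor x) = \pi_tensor (h x).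
Proof.
apply/pi_tensorP; rewrite -hB; apply: h_ker.
by apply/pi_tensorP; rewrite reprK.
Qed.

Lemma tensor_map_tmul p q : tensor_map f g (p ⊗t q) = f p ⊗t g q.
Proof. by rewrite /tmul tensor_map_pi hgen. Qed.

Lemma tensor_mapB : {morph tensor_map f g : s t / s - t}.
Proof.
move=> s t; rewrite -[s]reprK -[t]reprK -pi_tensorB.
by rewrite !tensor_map_pi hB pi_tensorB.
Qed.

Lemma tensor_map0 : tensor_map f g 0 = 0.
Proof. by rewrite -[0 in LHS](subrr 0) tensor_mapB subrr. Qed.

Lemma tensor_mapD : {morph tensor_map f g : s t / s + t}.
Proof.
move=> s t; rewrite -[t in LHS]opprK tensor_mapB -[- t]sub0r tensor_mapB.
by rewrite tensor_map0 sub0r opprK.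
Qed.

End TensorMap.

Definition tensor_lact (r : R) : tensor -> tensor := tensor_map (lact r) id.
Definition tensor_ract (t : tensor) (r : R) : tensor := tensor_map id (ract^~ r) t.

Let fDl r : {morph (lact r : P -> P) : x y / x + y}.
Proof. by move=> x y; apply: lactDr. Qed.
Let fDr r : {morph ((ract^~ r) : Q -> Q) : x y / x + y}.
Proof. by move=> x y; apply: ractDl. Qed.
Let g_lact r (s : R) (q : Q) : (s *>> q) <<* r = s *>> (q <<* r).
Proof. exact: lractA. Qed.
Let f_ract r (p : P) (s : R) : r *>> (p <<* s) = (r *>> p) <<* s.
Proof. by rewrite lractA. Qed.

Lemma tensor_lactE r p q : tensor_lact r (p ⊗t q) = (r *>> p) ⊗t q.
Proof. by rewrite /tensor_lact tensor_map_tmul. Qed.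

Lemma tensor_ractE r p q : tensor_ract (p ⊗t q) r = p ⊗t (q <<* r).
Proof. by rewrite /tensor_ract (tensor_map_tmul (g := ract^~ r)). Qed.

Lemma tensor_lactB r : {morph tensor_lact r : s t / s - t}.
Proof. exact: tensor_mapB. Qed.

Lemma tensor_ractB r : {morph tensor_ract^~ r : s t / s - t}.
Proof. exact: (tensor_mapB (g := ract^~ r)). Qed.

Lemma tensor_lactDr r s t : tensor_lact r (s + t) = tensor_lact r s + tensor_lact r t.
Proof. exact: tensor_mapD. Qed.

Lemma tensor_ractDl s t r : tensor_ract (s + t) r = tensor_ract s r + tensor_ract t r.
Proof. exact: (tensor_mapD (g := ract^~ r)). Qed.

Lemma tensor_eq_ind (f g : tensor -> tensor) :
  {morph f : s t / s - t} -> {morph g : s t / s - t} ->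
  (forall p q, f (p ⊗t q) = g (p ⊗t q)) -> forall t, f t = g t.
Proof.
move=> fB gB fg; apply: (@tensor_ind [set t | f t = g t]) => //; split=> /=.
  by rewrite -[0](subrr 0) fB gB !subrr.
by move=> x y /= ex ey; rewrite fB gB ex ey.
Qed.

Let addB (f g : tensor -> tensor) : {morph f : s t / s - t} ->
  {morph g : s t / s - t} -> {morph (fun t => f t + g t) : s t / s - t}.
Proof. by move=> fB gB s t; rewrite fB gB opprD addrACA. Qed.

Let compB (f g : tensor -> tensor) : {morph f : s t / s - t} ->
  {morph g : s t / s - t} -> {morph (fun t => f (g t)) : s t / s - t}.
Proof. by move=> fB gB s t; rewrite gB fB. Qed.

Lemma tensor_lactDl r s t : tensor_lact (r + s) t = tensor_lact r t + tensor_lact s t.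
Proof.
move: t; apply: tensor_eq_ind => [||p q]; first exact: tensor_lactB.
  by apply: addB; apply: tensor_lactB.
by rewrite !tensor_lactE lactDl tmulDl.
Qed.

Lemma tensor_lactA r s t : tensor_lact (r ** s) t = tensor_lact r (tensor_lact s t).
Proof.
move: t; apply: tensor_eq_ind => [||p q]; first exact: tensor_lactB.
  by apply: compB; apply: tensor_lactB.
by rewrite !tensor_lactE lactA.
Qed.

Lemma tensor_ractDr t r s : tensor_ract t (r + s) = tensor_ract t r + tensor_ract t s.
Proof.
move: t; apply: (@tensor_eq_ind (tensor_ract^~ (r + s))) => [||p q].
- exact: tensor_ractB.
- by apply: (@addB (tensor_ract^~ r) (tensor_ract^~ s)); apply: tensor_ractB.
- by rewrite !tensor_ractE ractDr tmulDr.
Qed.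

Lemma tensor_ractA t r s : tensor_ract t (r ** s) = tensor_ract (tensor_ract t r) s.
Proof.
move: t; apply: (@tensor_eq_ind (tensor_ract^~ (r ** s))) => [||p q].
- exact: tensor_ractB.
- by apply: (@compB (tensor_ract^~ s) (tensor_ract^~ r)); apply: tensor_ractB.
- by rewrite !tensor_ractE ractA.
Qed.

Lemma tensor_lractA r t s :
  tensor_ract (tensor_lact r t) s = tensor_lact r (tensor_ract t s).
Proof.
move: t; apply: (@tensor_eq_ind (fun t => tensor_ract (tensor_lact r t) s)) => [||p q].
- by apply: (@compB (tensor_ract^~ s)); [apply: tensor_ractB|apply: tensor_lactB].
- by apply: (@compB _ (tensor_ract^~ s)); [apply: tensor_lactB|apply: tensor_ractB].
- by rewrite tensor_lactE !tensor_ractE tensor_lactE.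
Qed.

HB.instance Definition _ := @Zmodule_isBimodule.Build R tensor
  tensor_lact tensor_ract tensor_lactDl tensor_lactDr tensor_lactA
  tensor_ractDl tensor_ractDr tensor_ractA tensor_lractA.

End Tensor.

Notation "P ⊗ Q" := (tensor P Q) : type_scope.
Notation "p ⊗t q" := (tmul p q) : ring_scope.

Section RightEndomorphisms.
Variables (R : rngType) (M : bimodType R).

Definition right_linear : {pred M -> M} := fun f =>
  `[< (forall x y, f (x + y) = f x + f y) /\ (forall x r, f (x <<* r) = f x <<* r) >].

Lemma ractBl (x y : M) (r : R) : (x - y) <<* r = x <<* r - y <<* r.
Proof. by apply/eqP; rewrite eq_sym subr_eq -ractDl subrK. Qed.

Lemma right_linear_closed : zmod_closed right_linear.
Proof.
split.
  apply/asboolP; split=> [x y|x r]; rewrite ?addr0 //.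
  have r0 : (0 : M) <<* r = 0 by rewrite -[0 in LHS](subrr (0 : M)) ractBl subrr.
  exact/esym/r0.
move=> f g /asboolP[fD fr] /asboolP[gD gr]; apply/asboolP.
have E x : (f - g) x = f x - g x by [].
split=> [x y|x r]; first by rewrite !E fD gD opprD addrACA.
by rewrite !E fr gr ractBl.
Qed.

HB.instance Definition _ :=
  GRing.isZmodClosed.Build (M -> M) right_linear right_linear_closed.

Record right_end : Type := RightEnd {
  right_end_fun :> M -> M;
  right_end_linear : right_end_fun \in right_linear
}.

HB.instance Definition _ := [isSub for right_end_fun].
HB.instance Definition _ := [Choice of right_end by <:].
HB.instance Definition _ := [SubChoice_isSubZmodule of right_end by <:].

Lemma right_linear_comp (f g : right_end) : f \o g \in right_linear.
Proof.
have /asboolP[fD fr] := right_end_linear f.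
have /asboolP[gD gr] := right_end_linear g; apply/asboolP.
by split=> [x y|x r] /=; rewrite ?gD ?gr.
Qed.

Definition right_end_mul (f g : right_end) : right_end :=
  RightEnd (right_linear_comp f g).

Lemma right_end_ext (f g : right_end) : f =1 g -> f = g.
Proof. by move=> fg; apply: val_inj; apply: funext. Qed.

Lemma right_end_mulA : associative right_end_mul.
Proof. by move=> f g h; apply: right_end_ext. Qed.

Lemma right_end_mulDl : left_distributive right_end_mul +%R.
Proof. by move=> f g h; apply: right_end_ext. Qed.

Lemma right_end_mulDr : right_distributive right_end_mul +%R.
Proof.
move=> f g h; apply: right_end_ext => x.
by have /asboolP[fD _] := right_end_linear f; exact: fD.
Qed.

HB.instance Definition _ := @Zmodule_isRng.Build right_end
  right_end_mul right_end_mulA right_end_mulDl right_end_mulDr.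

Lemma lact_right_linear (r : R) : (lact r : M -> M) \in right_linear.
Proof. by apply/asboolP; split=> [x y|x s]; [exact: lactDr|rewrite lractA]. Qed.

Definition Delta (r : R) : right_end := RightEnd (lact_right_linear r).

Lemma DeltaD r s : Delta (r + s) = Delta r + Delta s.
Proof. by apply: right_end_ext => x; apply: lactDl. Qed.

Lemma DeltaM r s : Delta (r ** s) = Delta r ** Delta s.
Proof. by apply: right_end_ext => x; apply: lactA. Qed.

Definition kerDelta : set R := [set r | Delta r = 0].

End RightEndomorphisms.

Arguments kerDelta {R} M.

Section Ideals.
Variable R : rngType.

Definition is_ideal (I : set R) : Prop :=
  is_subgroup I /\ forall r x, I x -> I (r ** x) /\ I (x ** r).

Definition ideal_mul (I J : set R) : set R :=
  addspan [set x ** y | x in I & y in J].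

Definition semiprime : Prop :=
  forall I : set R, is_ideal I -> ideal_mul I I = [set 0] -> I = [set 0].

Definition ideal_perp (J : set R) : set R :=
  [set x | forall y, J y -> x ** y = 0 /\ y ** x = 0].

End Ideals.

Arguments semiprime : clear implicits.

Section System.
Variables (R : rngType) (P Q : bimodType R).
Variable psi : {bimod P ⊗ Q -> regular_bimod R}.

Definition thetaQ (q : Q) (p : P) : Q -> Q := fun x => q <<* psi (p ⊗t x).
Definition thetaP (p : P) (q : Q) : P -> P := fun y => psi (y ⊗t q) *>> p.

Definition FP_Q : set (Q -> Q) := addspan [set thetaQ q p | q in [set: Q] & p in [set: P]].
Definition FQ_P : set (P -> P) := addspan [set thetaP p q | p in [set: P] & q in [set: Q]].

Definition condFS : Prop :=
  forall (A : set Q) (B : set P), finite_set A -> finite_set B ->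
  exists Theta Omega, [/\ FP_Q Theta, FQ_P Omega,
    forall q, A q -> Theta q = q & forall p, B p -> Omega p = p].

End System.

(* Main.v *)
(** The ideal [I = J^⊥ ∩ J] squares to zero for every two-sided ideal [J], since
    its left factors lie in [J^⊥] and its right factors in [J]; so it vanishes
    in a semiprime ring. Apply this to [J = ker Δ]. *)
Require Import Defs.

Set Implicit Arguments.
Unset Strict Implicit.
Unset Printing Implicit Defensive.

Import GRing.Theory.

Local Open Scope classical_set_scope.
Local Open Scope ring_scope.

Section Rng.
Variable R : rngType.

Lemma rng_mulBl (x y z : R) : (x - y) ** z = x ** z - y ** z.
Proof. by apply/eqP; rewrite eq_sym subr_eq -rng_mulDl subrK. Qed.

Lemma rng_mulBr (x y z : R) : x ** (y - z) = x ** y - x ** z.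
Proof. by apply/eqP; rewrite eq_sym subr_eq -rng_mulDr subrK. Qed.

Lemma rng_mul0r (x : R) : 0 ** x = 0.
Proof. by rewrite -[0 in LHS](subrr 0) rng_mulBl subrr. Qed.

Lemma rng_mulr0 (x : R) : x ** 0 = 0.
Proof. by rewrite -[0 in LHS](subrr 0) rng_mulBr subrr. Qed.

Lemma is_ideal_setI (I J : set R) : is_ideal I -> is_ideal J -> is_ideal (I `&` J).
Proof.
move=> [[I0 IB] IM] [[J0 JB] JM]; split; first split=> // x y [Ix Jx] [Iy Jy].
  by split; [apply: IB|apply: JB].
by move=> r x [/(IM r)[? ?] /(JM r)[? ?]].
Qed.

(** For [x] in [J^⊥] and [y] in [J], one product of [y] with [r ** x] or [x ** r] contains [x ** y]
    or [y ** x]. In the other, associativity moves [r] onto [y], and [J] absorbs it. *)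
Lemma is_ideal_perp (J : set R) : is_ideal J -> is_ideal (ideal_perp J).
Proof.
move=> [_ JM]; split; first split.
- by move=> y _; rewrite rng_mul0r rng_mulr0.
- move=> x y xJ yJ z Jz; have [xz zx] := xJ z Jz; have [yz zy] := yJ z Jz.
  by rewrite rng_mulBl rng_mulBr xz zx yz zy subrr.
- move=> r x xJ; split=> y Jy; have [ry yr] := JM r y Jy.
    have [xy _] := xJ y Jy; have [_ yrx] := xJ _ yr.
    by rewrite -rng_mulA xy rng_mulr0 rng_mulA yrx.
  have [_ yx] := xJ y Jy; have [xry _] := xJ _ ry.
  by rewrite -rng_mulA xry rng_mulA yx rng_mul0r.
Qed.

Lemma semiprime_perpI (J : set R) :
  semiprime R -> is_ideal J -> ideal_perp J `&` J = [set 0].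
Proof.
move=> Rsp idJ; apply: Rsp; first exact: is_ideal_setI (is_ideal_perp idJ) idJ.
(* [semiprime] asks for an equality of sets, so 0 must be shown to lie in the span of products. *)
have [S0 _] := addspan_subgroup [set x ** y | x in ideal_perp J `&` J & y in ideal_perp J `&` J].
apply/seteqP; split=> [|_ ->]; last exact: S0.
(* As {0} is a subgroup, only generators matter: [x] in [J^⊥] annihilates [y] in [J]. *)
apply: addspan_sub => [|_ [x [xJ _] [y [_ Jy] <-]]]; last exact: (xJ y Jy).1.
by split=> // x y -> ->; rewrite /= subrr.
Qed.

End Rng.

Section KerDelta.
Variables (R : rngType) (Q : bimodType R).

Lemma lactr0 (r : R) : r *>> (0 : Q) = 0.
Proof. by apply: (addrI (r *>> (0 : Q))); rewrite -lactDr !addr0. Qed.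

Lemma lact0r (q : Q) : (0 : R) *>> q = 0.
Proof. by apply: (addrI ((0 : R) *>> q)); rewrite -lactDl !addr0. Qed.

Lemma lactBl (r s : R) (q : Q) : (r - s) *>> q = r *>> q - s *>> q.
Proof. by apply/eqP; rewrite eq_sym subr_eq -lactDl subrK. Qed.

(** Equality in [right_end] is pointwise and its zero is the zero map, so ker Δ is the annihilator
    of [Q] under the left action. *)
Lemma kerDeltaP (r : R) : kerDelta Q r <-> forall q : Q, r *>> q = 0.
Proof.
split=> [r0 q|r0]; last by rewrite /kerDelta /=; apply: right_end_ext => q; apply: r0.
exact: (congr1 (fun f : right_end Q => f q) r0).
Qed.

Lemma is_ideal_kerDelta : is_ideal (kerDelta Q).
Proof.
split; first split.
- by apply/kerDeltaP => q; apply: lact0r.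
- by move=> r s /kerDeltaP r0 /kerDeltaP s0; apply/kerDeltaP => q; rewrite lactBl r0 s0 subrr.
(* [s ** r] sends [q] to [s *>> 0], whereas in [r ** s] the factor [r] kills the element [s *>> q]
   of [Q]. *)
- by move=> s r /kerDeltaP r0; split; apply/kerDeltaP => q; rewrite lactA r0 ?lactr0.
Qed.

End KerDelta.

Theorem lemma5p3 (R : rngType) (P Q : bimodType R)
    (psi : {bimod P ⊗ Q -> regular_bimod R}) :
  semiprime R -> condFS psi ->
  ideal_perp (kerDelta Q) `&` kerDelta Q = [set 0].
Proof. by move=> Rsp _; apply: semiprime_perpI Rsp (is_ideal_kerDelta Q). Qed.
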